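(* For each $n$ let $f_n:S_n\to\mathbb{R}$ be a class function such that $f_n(\sigma)$, with $\sigma$ uniform on $S_n$, has a weak limit (converges in distribution) as $n\to\infty$. Then, under the uniform measures on $S_n$, Spearman's uniform metric, in its normalized form $\frac{1}{\sqrt n}(n-\rho_\infty(\sigma))$, is asymptotically independent from the sequence $f_n(\sigma)$.
   Context: $S_n$ is the symmetric group on $[n]=\{1,\ldots,n\}$, and $\rho_\infty(\sigma)=\max_{i\le n}|i-\sigma(i)|$ (''metric'' here means the distance from $\sigma$ to the identity). A class function is a function constant on conjugacy classes. Sequences of real random variables $X_n,Y_n$ are (weakly) asymptotically independent if for all bounded continuous $f,g:\mathbb{R}\to\mathbb{R}$, $\lim_n\mathbb{E}[f(X_n)g(Y_n)]=\lim_n\mathbb{E}f(X_n)\,\lim_n\mathbb{E}g(Y_n)$. *)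

(* Defs.v *)
From mathcomp Require Import all_boot all_order all_algebra all_fingroup.
From mathcomp Require Import all_classical all_reals all_analysis.

Set Implicit Arguments.
Unset Strict Implicit.
Unset Printing Implicit Defensive.

Import Order.TTheory GRing.Theory Num.Theory.
Import numFieldNormedType.Exports.

Local Open Scope classical_set_scope.
Local Open Scope ring_scope.

(* The set [n] = {1, ..., n} is represented by 'I_n = {0, ..., n-1}; the shift
   by one does not affect conjugacy or the differences |i - s i|. *)

(* Expectation of X(s) for s uniform on S_n. *)
Definition perm_expectation (R : realType) (n : nat) (X : 'S_n -> R) : R :=
  (\sum_(s : 'S_n) X s) / #|[set: 'S_n]%SET|%:R.

(* Real-valued, unlike the algC-valued class functions of classfun.v. *)
Definition class_function (R : realType) (n : nat) (f : 'S_n -> R) : Prop :=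
  forall s t : 'S_n, f (s ^ t)%g = f s.

(* Since i and s i are coerced to nat, `|i - s i|%N is the distance |i - s i|
   of integers, not a truncated difference. *)
Definition spearman_uniform (n : nat) (s : 'S_n) : nat :=
  (\max_(i < n) `|i - s i|)%N.

Definition normalized_spearman (R : realType) (n : nat) (s : 'S_n) : R :=
  (Num.sqrt n%:R)^-1 * (n%:R - (spearman_uniform s)%:R).

Definition has_weak_limit (R : realType) (X : forall n, 'S_n -> R) : Prop :=
  exists mu : probability (measurableTypeR R) R,
    forall g : R -> R, bounded_fun g -> continuous g ->
      (perm_expectation (fun s : 'S_n => g (X n s)) @[n --> \oo]
         --> Rintegral mu setT g).

(* [lim] is a total operator with a junk value on divergent sequences, hence
   the explicit convergence of the three sequences. *)
Definition asymptotically_independent (R : realType)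
    (X Y : forall n, 'S_n -> R) : Prop :=
  forall f g : R -> R,
    bounded_fun f -> continuous f -> bounded_fun g -> continuous g ->
    let EfX : R ^nat := fun n => perm_expectation (fun s : 'S_n => f (X n s)) in
    let EgY : R ^nat := fun n => perm_expectation (fun s : 'S_n => g (Y n s)) in
    let EfXgY : R ^nat :=
      fun n => perm_expectation (fun s : 'S_n => f (X n s) * g (Y n s)) in
    [/\ cvgn EfX, cvgn EgY, cvgn EfXgY & limn EfXgY = limn EfX * limn EgY].

(* Main.v *)
(* For x >= 0, (n - rho(s)) / sqrt n > x means that the graph of s avoids two
   opposite triangular corners of the n x n grid, N ~ x^2 n cells in all.
   Adding the cells of a sparse set B one by one, a switching argument shows
   that each new cell multiplies the probability of avoidance by about 1 - 1/n,
   so it is close to (1 - 1/n)^#|B| and tends to exp(- x^2) for the corners.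
   For a random conjugate s^t, the joint event for s and s^t is the avoidance
   of the union of the corners with their image under t, which has about 2 N
   cells; hence the two events are asymptotically independent. Therefore the
   conditional probability of the event given the conjugacy class of s is
   asymptotically constant in L^2, and the event is asymptotically uncorrelated
   with bounded class functions. Step functions and tightness extend this from
   indicators of half-lines to bounded continuous functions. *)
Require Import Defs.
From mathcomp Require Import all_boot all_order all_algebra all_fingroup.
From mathcomp Require Import all_classical all_reals all_analysis.
From mathcomp Require Import zify lra ring.

Set Implicit Arguments.
Unset Strict Implicit.
Unset Printing Implicit Defensive.

Import Order.TTheory GRing.Theory Num.Theory.
Import numFieldNormedType.Exports.

Local Open Scope ring_scope.

(** * Expectations and image probabilities of a uniform permutation *)

Section UniformPermutation.
Variables (R : realType) (n : nat).
Implicit Types (X Y : 'S_n -> R) (s t : 'S_n) (i j a b : 'I_n).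
Implicit Types (B : {set 'I_n * 'I_n}).

Local Notation E := (@perm_expectation R n).

Lemma expectation_eq X Y : X =1 Y -> E X = E Y.
Proof. by move=> XY; rewrite /perm_expectation (eq_bigr Y). Qed.

Lemma expectation_cst (c : R) : E (fun=> c) = c.
Proof.
rewrite /perm_expectation sumr_const cardsT -[c *+ _]mulr_natr mulfK//.
by rewrite pnatr_eq0 -lt0n; apply/card_gt0P; exists 1%g.
Qed.

Lemma expectationD X Y : E (fun s => X s + Y s) = E X + E Y.
Proof. by rewrite /perm_expectation big_split mulrDl. Qed.

Lemma expectationZ (c : R) X : E (fun s => c * X s) = c * E X.
Proof. by rewrite /perm_expectation -mulr_sumr mulrA. Qed.

Lemma expectationB X Y : E (fun s => X s - Y s) = E X - E Y.
Proof. by rewrite /perm_expectation sumrB mulrBl. Qed.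

Lemma expectation_sum (I : finType) (P : pred I) (F : I -> 'S_n -> R) :
  E (fun s => \sum_(x | P x) F x s) = \sum_(x | P x) E (F x).
Proof. by rewrite /perm_expectation exchange_big mulr_suml. Qed.

Lemma expectation_exchange (F : 'S_n -> 'S_n -> R) :
  E (fun s => E (F s)) = E (fun t => E (F^~ t)).
Proof. by rewrite /perm_expectation -!mulr_suml exchange_big. Qed.

Lemma expectation_le X Y : (forall s, X s <= Y s) -> E X <= E Y.
Proof.
by move=> XY; rewrite /perm_expectation ler_wpM2r ?invr_ge0// ler_sum.
Qed.

Lemma expectation_norm X : `|E X| <= E (fun s => `|X s|).
Proof.
rewrite /perm_expectation normrM [X in _ * X]ger0_norm ?invr_ge0//.
by rewrite ler_wpM2r ?invr_ge0// ler_norm_sum.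
Qed.

Lemma expectation_reindex (h : 'S_n -> 'S_n) X :
  injective h -> E (fun s => X (h s)) = E X.
Proof. by move=> hI; rewrite /perm_expectation [in RHS](reindex_inj hI). Qed.

Lemma sum_indic_eq (T : finType) (x : T) : \sum_y (x == y)%:R = 1 :> R.
Proof.
by rewrite (bigD1 x)//= eqxx big1 ?addr0// => y; rewrite eq_sym => /negbTE->.
Qed.

(** Multiplying by [tperm j b] preserves the uniform law and exchanges the values [j] and [b], so
    all [n] values are equally likely. *)
Lemma prob_image i j : E (fun s => (s i == j)%:R) = n%:R^-1.
Proof.
have n0 : n%:R != 0 :> R by case: n i => [[]|m _]//; rewrite pnatr_eq0.
suff h : n%:R * E (fun s => (s i == j)%:R) = 1.
  by apply: (mulfI n0); rewrite h divff.
transitivity (\sum_b E (fun s => (s i == b)%:R)).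
  transitivity (\sum_(b : 'I_n) E (fun s => (s i == j)%:R)).
    by rewrite sumr_const card_ord mulr_natl.
  apply: eq_bigr => b _.
  rewrite -(@expectation_reindex (fun s => s * tperm j b)%g).
    by apply: expectation_eq => s; rewrite permM (canF_eq (tpermK j b)) tpermL.
  exact: mulIg.
rewrite -expectation_sum -[RHS](expectation_cst 1).
by apply: expectation_eq => s; rewrite sum_indic_eq.
Qed.

(** Given [s a = j], the values [c != j] of [s i] are equally likely by a transposition argument,
    and these disjoint events have total probability at most [1 / n]. An inequality also covers the
    impossible case [b = j]. *)
Lemma prob_image2 i a j b : a != i ->
  E (fun s => ((s a == j) && (s i == b))%:R) <= (n%:R * (n.-1)%:R)^-1.
Proof.
move=> ai; have n1 : (1 < n)%N.
  by case: n i a ai => [[]//|[|m]]// i a; rewrite !ord1 eqxx.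
have n10 : 0 < (n.-1)%:R :> R by rewrite ltr0n -subn1 subn_gt0.
have [->|bj] := eqVneq b j.
  rewrite -[leLHS](_ : 0 = _); first by rewrite invr_ge0 mulr_ge0.
  rewrite -(expectation_cst 0); apply: expectation_eq => s.
  by case: eqP => // <-; rewrite (inj_eq perm_inj) eq_sym (negbTE ai).
rewrite invfM ler_pdivlMr// mulrC.
rewrite -(prob_image a j); apply: (@le_trans _ _
   (\sum_(c | c != j) E (fun s => ((s a == j) && (s i == c))%:R))).
  apply: (@le_trans _ _
     (\sum_(c | c != j) E (fun s => ((s a == j) && (s i == b))%:R))).
    by rewrite sumr_const cardC1 card_ord mulr_natl.
  apply: ler_sum => c cj.
  rewrite -(@expectation_reindex (fun s => s * tperm b c)%g); last exact: mulIg.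
  apply: expectation_le => s; rewrite !permM.
  by rewrite !(canF_eq (tpermK b c)) tpermL tpermD.
rewrite -expectation_sum; apply: expectation_le => s.
case: eqP => sa; last by rewrite big1.
rewrite -[leRHS](sum_indic_eq (s i)) [leRHS](bigID (fun c => c != j))/=.
by rewrite lerDl sumr_ge0.
Qed.

(** * Probability of avoiding a sparse set of cells *)

Definition avoids B s : bool := [forall i, (i, s i) \notin B].

Definition avoid_prob B : R := E (fun s => (avoids B s)%:R).

Lemma avoidsP B s : reflect (forall i, (i, s i) \notin B) (avoids B s).
Proof. exact: forallP. Qed.

Lemma avoidsU1 B s i j :
  avoids ((i, j) |: B) s = (s i != j) && avoids B s.
Proof.
apply/avoidsP/andP => [h|[sij /avoidsP h] k].
  split; first by have := h i; rewrite !inE negb_or xpair_eqE eqxx => /andP[].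
  by apply/avoidsP => k; have := h k; rewrite !inE negb_or => /andP[].
rewrite !inE negb_or h andbT xpair_eqE; apply/negP => /andP[/eqP-> /eqP e].
by rewrite e eqxx in sij.
Qed.

(** The switch replaces the cells [(i, s i)] and [(a, s a)] of the graph by [(i, s a)] and
    [(a, s i)]. The first new cell is outside [B], so avoidance can change only if one of the other
    three cells lies in [B]. *)
Lemma avoids_switch B s i a : (i, s a) \notin B ->
  `|(avoids B (tperm i a * s)%g)%:R - (avoids B s)%:R| <=
    ((i, s i) \in B)%:R + ((a, s a) \in B)%:R
    + ((a != i) && ((a, s i) \in B))%:R :> R.
Proof.
move=> iB.
have [->|ai] := eqVneq a i; first by rewrite tperm1 mul1g subrr normr0 !addr_ge0.
case iiB : ((i, s i) \in B).
  rewrite -addrA (@le_trans _ _ 1)// ?lerDl ?addr_ge0//.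
  by do 2![case: avoids]; rewrite ?subrr ?subr0 ?sub0r ?normr0 ?normrN ?normr1.
case aaB : ((a, s a) \in B).
  rewrite addrAC add0r (@le_trans _ _ 1)// ?lerDr//.
  by do 2![case: avoids]; rewrite ?subrr ?subr0 ?sub0r ?normr0 ?normrN ?normr1.
case aiB : ((a, s i) \in B).
  rewrite !add0r/=.
  by do 2![case: avoids]; rewrite ?subrr ?subr0 ?sub0r ?normr0 ?normrN ?normr1.
rewrite (_ : avoids B (tperm i a * s)%g = avoids B s) ?subrr ?normr0 ?addr_ge0//.
apply/avoidsP/avoidsP => h k; have := h k; rewrite permM;
  case: tpermP => [->|->|]; rewrite ?iiB ?aaB ?aiB ?iB//.
Qed.

Lemma card_pair_sum B : \sum_a \sum_b ((a, b) \in B)%:R = #|B|%:R :> R.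
Proof.
rewrite pair_bigA/= -sum1_card natr_sum [RHS]big_mkcond/=.
by apply: eq_bigr => -[a b] _ /=; case: (_ \in B).
Qed.

Lemma card_row_sum B i :
  \sum_b ((i, b) \in B)%:R = #|[set b | (i, b) \in B]|%:R :> R.
Proof.
rewrite -sum1_card natr_sum [RHS]big_mkcond/=.
by apply: eq_bigr => b _ /=; rewrite inE; case: (_ \in B).
Qed.

Lemma card_col_sum B j :
  \sum_a ((a, j) \in B)%:R = #|[set a | (a, j) \in B]|%:R :> R.
Proof.
rewrite -sum1_card natr_sum [RHS]big_mkcond/=.
by apply: eq_bigr => b _ /=; rewrite inE; case: (_ \in B).
Qed.

Lemma sum_indic_mul (T : finType) (F : T -> R) x :
  \sum_y F y * (x == y)%:R = F x.
Proof.
rewrite (bigD1 x)//= eqxx mulr1 big1 ?addr0// => y.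
by rewrite eq_sym => /negbTE->; rewrite mulr0.
Qed.

(* Resampling: composing a uniform s with a transposition that moves the
   preimage of j to i is an n-to-1 map onto the permutations with s i = j, and
   it rarely changes whether B is avoided. *)
Lemma avoid_prob_switch B i j : (i, j) \notin B ->
  `|n%:R * E (fun s => (avoids B s && (s i == j))%:R) - avoid_prob B| <=
   (#|[set b | (i, b) \in B]|%:R + #|[set a | (a, j) \in B]|%:R) / n%:R
   + #|B|%:R / (n%:R * (n.-1)%:R).
Proof.
move=> ijB.
have -> : n%:R * E (fun s => (avoids B s && (s i == j))%:R) =
    \sum_a E (fun s => (avoids B (tperm i a * s)%g && (s a == j))%:R).
  transitivity (\sum_(a : 'I_n) E (fun s => (avoids B s && (s i == j))%:R)).
    by rewrite sumr_const card_ord mulr_natl.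
  apply: eq_bigr => a _.
  rewrite -(@expectation_reindex (mulg (tperm i a))); last exact: mulgI.
  by apply: expectation_eq => s; rewrite permM tpermL.
have -> : avoid_prob B = \sum_a E (fun s => (avoids B s && (s a == j))%:R).
  rewrite -expectation_sum; apply: expectation_eq => s.
  transitivity (\sum_a (avoids B s)%:R * (s a == j)%:R : R).
    rewrite -mulr_sumr (reindex_inj (@perm_inj _ s^-1%g)) /=.
    under eq_bigr do rewrite permKV eq_sym.
    by rewrite sum_indic_eq mulr1.
  by apply: eq_bigr => a _; rewrite -natrM mulnb.
rewrite -sumrB (le_trans (ler_norm_sum _ _ _))//.
(* The three terms are the three ways in which a switch can matter when [s a = j]. Summed over [a],
   they are governed by row [i] of [B], column [j] of [B], and all of [B]. *)
apply: (@le_trans _ _ (\sum_a (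
    E (fun s => (s a == j)%:R * ((i, s i) \in B)%:R)
    + ((a, j) \in B)%:R * E (fun s => (s a == j)%:R)
    + \sum_b ((a, b) \in B)%:R *
      ((a != i)%:R * E (fun s => ((s a == j) && (s i == b))%:R))))).
  apply: ler_sum => a _; rewrite -expectationB.
  apply: (le_trans (expectation_norm _)).
  rewrite -expectationZ -expectationD.
  under [X in _ <= _ + X]eq_bigr do rewrite -!expectationZ.
  rewrite -expectation_sum -expectationD; apply: expectation_le => s.
  case: eqP => sa; last first.
    by rewrite !andbF subrr normr0 !addr_ge0 ?mulr_ge0 ?sumr_ge0.
  rewrite !andbT mul1r mulr1 -sa.
  apply: le_trans (avoids_switch _) _; first by rewrite sa.
  rewrite lerD2l -mulnb natrM.
  rewrite -(sum_indic_mul (fun b => ((a, b) \in B)%:R) (s i)) mulr_sumr.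
  by apply: ler_sum => b _; rewrite mulrCA.
rewrite !big_split/=; apply: lerD.
  rewrite mulrDl -card_row_sum -card_col_sum !mulr_suml; apply: lerD.
    have -> : \sum_b ((i, b) \in B)%:R / n%:R = E (fun s => ((i, s i) \in B)%:R).
      under eq_bigr => b _ do rewrite -(prob_image i b) -expectationZ.
      rewrite -expectation_sum; apply: expectation_eq => s.
      exact: (sum_indic_mul (fun b => ((i, b) \in B)%:R)).
    rewrite -expectation_sum; apply: expectation_le => s; rewrite -mulr_suml.
    rewrite (reindex_inj (@perm_inj _ s^-1%g)) /=.
    under eq_bigr do rewrite permKV eq_sym.
    by rewrite sum_indic_eq mul1r.
  by apply: ler_sum => a _; rewrite prob_image.
rewrite -card_pair_sum mulr_suml; apply: ler_sum => a _.
rewrite mulr_suml; apply: ler_sum => b _; rewrite ler_wpM2l//.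
have [->|ai] := eqVneq a i; first by rewrite mul0r invr_ge0 mulr_ge0.
by rewrite mul1r prob_image2.
Qed.

(** Each cell removed from [B] accounts for a factor [q = 1 - 1/n] up to an error [e / n]. Since
    [0 <= q <= 1], earlier errors are not amplified and they add up linearly. *)
Lemma avoid_prob_approx B d : (0 < n)%N ->
  (forall i, #|[set b | (i, b) \in B]| <= d)%N ->
  (forall j, #|[set a | (a, j) \in B]| <= d)%N ->
  `|avoid_prob B - (1 - n%:R^-1) ^+ #|B| | <= #|B|%:R / n%:R *
     ((d%:R *+ 2) / n%:R + #|B|%:R / (n%:R * (n.-1)%:R)).
Proof.
move=> n0 rowB colB; set q := 1 - _; set e := _ / _ + _.
have n0R : 0 < n%:R :> R by rewrite ltr0n.
have q01 : 0 <= q <= 1.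
  by rewrite subr_ge0 invf_le1// ler1n n0 lerBlDr lerDl invr_ge0 ler0n.
(* The induction runs over subsets of [B], so that [d] and the error [e], which depends on [#|B|],
   stay fixed. *)
suff H : forall m (C : {set 'I_n * 'I_n}), C \subset B -> #|C| = m ->
    `|avoid_prob C - q ^+ m| <= m%:R / n%:R * e by exact: H.
elim=> [|m IH] C CB Cm.
  rewrite !mul0r (_ : avoid_prob C = 1) ?subrr ?normr0//.
  rewrite -[RHS]expectation_cst; apply: expectation_eq => s.
  by rewrite (cards0_eq Cm) (_ : avoids _ s)//; apply/avoidsP => i; rewrite inE.
have /card_gt0P[[i j] ijC] : (0 < #|C|)%N by rewrite Cm.
pose D := C :\ (i, j).
have CD : C = (i, j) |: D by rewrite finset.setD1K.
have DB : D \subset B by apply: fintype.subset_trans CB; rewrite finset.subsetDl.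
have Dm : #|D| = m by move: Cm; rewrite (cardsD1 (i, j)) ijC => -[].
have ijD : (i, j) \notin D by rewrite !inE eqxx.
have DE : avoid_prob C =
    avoid_prob D - E (fun s => (avoids D s && (s i == j))%:R).
  rewrite /avoid_prob -expectationB; apply: expectation_eq => s.
  rewrite CD avoidsU1 andbC; case: (avoids D s) => /=; last by rewrite subrr.
  by case: eqP => _; rewrite ?subrr ?subr0.
have := avoid_prob_switch ijD; set p := E _ => sw.
have {}sw : `|p - avoid_prob D / n%:R| <= e / n%:R.
  rewrite ler_pdivlMr// -[X in _ * X]ger0_norm ?(ltW n0R)// -normrM mulrBl.
  rewrite mulfVK ?gt_eqF// mulrC (le_trans sw)// /e.
  rewrite lerD// ler_wpM2r ?invr_ge0 ?mulr_ge0//; last first.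
    by rewrite ler_nat subset_leq_card.
  rewrite mulr2n lerD// ler_nat.
    apply: leq_trans (rowB i); apply: subset_leq_card.
    by apply/fintype.subsetP => b; rewrite !inE => /andP[_ /(fintype.subsetP CB)].
  apply: leq_trans (colB j); apply: subset_leq_card.
  by apply/fintype.subsetP => b; rewrite !inE => /andP[_ /(fintype.subsetP CB)].
have -> : avoid_prob C - q ^+ m.+1 =
    q * (avoid_prob D - q ^+ m) - (p - avoid_prob D / n%:R).
  by rewrite DE -/p exprS /q; ring.
apply: le_trans (ler_normB _ _) _.
have -> : m.+1%:R / n%:R * e = m%:R / n%:R * e + e / n%:R.
  by rewrite -natr1; ring.
rewrite lerD//.
rewrite normrM ger0_norm; last by case/andP: q01.
apply: le_trans (IH _ DB Dm); rewrite ler_piMl//.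
by case/andP: q01.
Qed.

End UniformPermutation.

(** * Class functions and random conjugates *)

Section Conjugation.
Variables (R : realType) (n : nat).
Implicit Types (s t : 'S_n) (i j : 'I_n) (B C : {set 'I_n * 'I_n}).

Local Notation E := (@perm_expectation R n).

(** For each fixed [t], [s ^ t] is again uniform and [G] takes the same value at it as at [s]. *)
Lemma class_function_expectation (D G : 'S_n -> R) : class_function G ->
  E (fun s => D s * G s) = E (fun s => E (fun t => D (s ^ t)%g) * G s).
Proof.
move=> Gc; rewrite -[LHS](expectation_cst n).
under [RHS]expectation_eq => s do rewrite mulrC -expectationZ.
rewrite [RHS]expectation_exchange; apply: expectation_eq => t.
rewrite -(@expectation_reindex _ _ (conjg^~ t)); last exact: conjg_inj.
by apply: expectation_eq => s; rewrite Gc mulrC.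
Qed.

Lemma class_function_average (D : 'S_n -> R) :
  class_function (fun s => E (fun t => D (s ^ t)%g)).
Proof.
move=> s u; rewrite -[RHS](@expectation_reindex _ _ (mulg u)); last exact: mulgI.
by apply: expectation_eq => t; rewrite conjgM.
Qed.

Lemma expectation_sqr_le (X : 'S_n -> R) : E X ^+ 2 <= E (fun s => X s ^+ 2).
Proof.
have : 0 <= E (fun s => (X s - E X) ^+ 2).
  by rewrite -[leLHS](expectation_cst n); apply: expectation_le => s; rewrite sqr_ge0.
rewrite (_ : E _ = E (fun s => X s ^+ 2 - (2 * E X * X s - E X ^+ 2))).
  by rewrite !expectationB expectationZ expectation_cst; lra.
by apply: expectation_eq => s; ring.
Qed.

(* Averaging over the conjugates of s turns the expectation against a class
   function into a covariance between s and an independent conjugate of s. *)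
Lemma class_function_decorrelation (D G : 'S_n -> R) (K : R) :
  class_function G -> (forall s, `|G s| <= K) ->
  `|E (fun s => D s * G s)| <=
    K * Num.sqrt (E (fun s => E (fun t => D s * D (s ^ t)%g))).
Proof.
move=> Gc GK; have K0 : 0 <= K := le_trans (normr_ge0 _) (GK 1%g).
rewrite class_function_expectation//; pose h s := E (fun t => D (s ^ t)%g).
change (fun s => E (fun t => D (s ^ t)%g) * G s) with (fun s => h s * G s).
apply: (@le_trans _ _ (K * E (fun s => `|h s|))).
  rewrite -expectationZ; apply: le_trans (expectation_norm _) _.
  by apply: expectation_le => s /=; rewrite normrM mulrC ler_wpM2r.
rewrite ler_wpM2l//.
(* The average [h] is itself a class function, so [E (D h) = E (h^2)]. The covariance is therefore
   the squared L^2 norm of [h], which dominates its L^1 norm. *)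
have -> : E (fun s => E (fun t => D s * D (s ^ t)%g)) = E (fun s => `|h s| ^+ 2).
  transitivity (E (fun s => D s * h s)).
    by apply: expectation_eq => s; rewrite expectationZ.
  rewrite class_function_expectation; last exact: class_function_average.
  by apply: expectation_eq => s; rewrite real_normK ?num_real.
rewrite -[leLHS]ger0_norm; last first.
  by rewrite -[leLHS](expectation_cst n); apply: expectation_le.
by rewrite -sqrtr_sqr ler_wsqrtr// expectation_sqr_le.
Qed.

(** A preimage, because the graph of [s ^ t] is the image of the graph of [s] under [t] acting on
    both coordinates. *)
Definition conj_set t B : {set 'I_n * 'I_n} := [set p | (t p.1, t p.2) \in B].

Lemma avoids_conj B s t : avoids B (s ^ t)%g = avoids (conj_set t B) s.
Proof.
apply/avoidsP/avoidsP => h i.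
  by rewrite inE -permJ; exact: h.
by have := h (t^-1%g i); rewrite inE -(permKV t i) permJ permK.
Qed.

Lemma avoidsU B C s : avoids (B :|: C) s = avoids B s && avoids C s.
Proof.
apply/avoidsP/andP => [h|[/avoidsP hB /avoidsP hC] i].
  by split; apply/avoidsP => i; have := h i; rewrite inE negb_or => /andP[].
by rewrite inE negb_or hB hC.
Qed.

Lemma card_conj_set t B : #|conj_set t B| = #|B|.
Proof.
rewrite /conj_set -(card_preimset B (f := fun p => (t p.1, t p.2))).
  by apply: eq_card => p; rewrite !inE.
by move=> [i j] [k l] /= [/perm_inj-> /perm_inj->].
Qed.

Lemma card_row_conj_set t B i :
  #|[set j | (i, j) \in conj_set t B]| = #|[set j | (t i, j) \in B]|.
Proof.
rewrite -(card_preimset [set j | (t i, j) \in B] (@perm_inj _ t)).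
by apply: eq_card => j; rewrite !inE.
Qed.

Lemma card_col_conj_set t B j :
  #|[set i | (i, j) \in conj_set t B]| = #|[set i | (i, t j) \in B]|.
Proof.
rewrite -(card_preimset [set i | (i, t j) \in B] (@perm_inj _ t)).
by apply: eq_card => i; rewrite !inE.
Qed.

(** First moment count over pairs of cells [p], [q] of [B] such that [t] carries [p] to [q]. Cells
    off the diagonal have two distinct coordinates, as [prob_image2] demands. *)
Lemma expectation_card_conj_setI B : (forall i, (i, i) \notin B) ->
  E (fun t => #|B :&: conj_set t B|%:R) <= #|B|%:R ^+ 2 / (n%:R * (n.-1)%:R).
Proof.
move=> Bd; apply: (@le_trans _ _ (\sum_(p in B) \sum_(q in B)
    E (fun t => ((t p.1 == q.1) && (t p.2 == q.2))%:R))).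
  under [leRHS]eq_bigr do rewrite -expectation_sum.
  rewrite -expectation_sum; apply: expectation_le => t.
  rewrite -sum1_card natr_sum.
  under eq_bigl do rewrite inE.
  rewrite big_mkcondr /=; apply: ler_sum => p pB.
  rewrite inE; case: ifP => tpB; last by rewrite sumr_ge0.
  rewrite (bigD1 (t p.1, t p.2))//= !eqxx lerDl sumr_ge0//.
apply: (@le_trans _ _ (\sum_(p in B) \sum_(q in B) (n%:R * (n.-1)%:R)^-1)).
  apply: ler_sum => -[i j] ijB; apply: ler_sum => q _.
  apply: prob_image2; apply: contraTneq ijB => /= ->; exact: Bd.
by rewrite !sumr_const -[_ *+ _ *+ _]mulrnA -[leLHS]mulr_natl natrM expr2.
Qed.

Lemma expr_sub_le (q : R) m l : 0 <= q <= 1 ->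
  `|q ^+ m - q ^+ (m + l)| <= l%:R * (1 - q).
Proof.
move=> /andP[q0 q1]; rewrite ger0_norm; last first.
  by rewrite subr_ge0 ler_wiXn2l// leq_addr.
elim: l => [|l IH]; first by rewrite addn0 subrr mul0r.
rewrite addnS exprSr -natr1.
have : q ^+ (m + l) * (1 - q) <= 1 * (1 - q).
  by rewrite ler_wpM2r ?subr_ge0// exprn_ile1.
lra.
Qed.

(** The error in [avoid_prob_approx] for [N] cells, at most [d] in each row and column. *)
Definition avoid_error (N d : nat) : R :=
  N%:R / n%:R * ((d%:R *+ 2) / n%:R + N%:R / (n%:R * (n.-1)%:R)).

Lemma avoid_error_le N N' d : (N <= N')%N -> avoid_error N d <= avoid_error N' d.
Proof.
move=> NN'; rewrite /avoid_error ler_pM ?addr_ge0 ?divr_ge0 ?mulr_ge0 ?mulrn_wge0//.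
  by rewrite ler_wpM2r ?invr_ge0// ler_nat.
by rewrite lerD2l ler_wpM2r ?invr_ge0 ?mulr_ge0// ler_nat.
Qed.

Definition centered_avoids B s : R := (avoids B s)%:R - avoid_prob R B.

(** The joint avoidance probability and the squared one are both compared with [q ^+ (N + N)]. The
    three errors come from the approximation for the union, from the expected overlap of [B] with
    its conjugate, and from the approximation for [B], doubled by squaring. *)
Lemma avoid_covariance B d : (0 < n)%N -> (forall i, (i, i) \notin B) ->
  (forall i, #|[set b | (i, b) \in B]| <= d)%N ->
  (forall j, #|[set a | (a, j) \in B]| <= d)%N ->
  E (fun s => E (fun t => centered_avoids B s * centered_avoids B (s ^ t)%g)) <=
    avoid_error #|B|.*2 d.*2 + #|B|%:R ^+ 2 / (n%:R * (n.-1)%:R) / n%:R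
    + avoid_error #|B| d *+ 2.
Proof.
move=> n0 Bd rowB colB; set D := centered_avoids B; set P := avoid_prob R B.
pose q : R := 1 - n%:R^-1; pose N := #|B|.
have n0R : 0 < n%:R :> R by rewrite ltr0n.
have q01 : 0 <= q <= 1.
  by rewrite subr_ge0 invf_le1// ler1n n0 lerBlDr lerDl invr_ge0 ler0n.
have -> : E (fun s => E (fun t => D s * D (s ^ t)%g)) =
    E (fun t => avoid_prob R (B :|: conj_set t B)) - P ^+ 2.
  rewrite expectation_exchange -[X in _ - X](expectation_cst n) -expectationB.
  apply: expectation_eq => t.
  transitivity (E (fun s => (avoids (B :|: conj_set t B) s)%:R
     - P * ((avoids B s)%:R + (avoids B (s ^ t)%g)%:R - P))).
    apply: expectation_eq => s; rewrite avoidsU -avoids_conj -mulnb natrM.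
    by rewrite /D /centered_avoids -/P; ring.
  rewrite expectationB expectationZ expectationB expectationD expectation_cst.
  rewrite (@expectation_reindex _ _ (conjg^~ t) (fun s => (avoids B s)%:R));
    last exact: conjg_inj.
  by rewrite -/(avoid_prob R B) -/(avoid_prob R _) -/P; ring.
have PB : `|P - q ^+ N| <= avoid_error N d := avoid_prob_approx R n0 rowB colB.
have P01 : 0 <= P <= 1.
  apply/andP; split; [rewrite -[leLHS](expectation_cst n)
    | rewrite -[leRHS](expectation_cst n)];
  by apply: expectation_le => s; case: avoids.
have qN01 : 0 <= q ^+ N <= 1.
  by case/andP: q01 => ? ?; rewrite exprn_ge0// exprn_ile1.
have P2 : q ^+ (N + N) - P ^+ 2 <= avoid_error N d *+ 2.
  apply: le_trans (ler_norm _) _; rewrite distrC exprD -expr2 subr_sqr normrM.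
  rewrite -[leRHS]mulr_natr ler_pM// ger0_norm ?addr_ge0//;
    try by case/andP: P01; case/andP: qN01.
  by move: P01 qN01; lra.
have PU t : avoid_prob R (B :|: conj_set t B) - q ^+ (N + N) <=
    avoid_error N.*2 d.*2 + n%:R^-1 * #|B :&: conj_set t B|%:R.
  have cU : (#|B :|: conj_set t B| + #|B :&: conj_set t B| = N + N)%N.
    by rewrite cardsUI card_conj_set.
  have H1 : `|avoid_prob R (B :|: conj_set t B) - q ^+ #|B :|: conj_set t B| |
      <= avoid_error N.*2 d.*2.
    apply: (@le_trans _ _ (avoid_error #|B :|: conj_set t B| d.*2)); last first.
      by apply: avoid_error_le; rewrite -addnn -cU leq_addr.
    apply: avoid_prob_approx => // i.
      apply: (@leq_trans
        #|[set b | (i, b) \in B] :|: [set b | (i, b) \in conj_set t B]|).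
        by apply: subset_leq_card; apply/fintype.subsetP => b; rewrite !inE.
      by rewrite -addnn (leq_trans (leq_card_setU _ _))// leq_add// card_row_conj_set.
    apply: (@leq_trans
      #|[set b | (b, i) \in B] :|: [set b | (b, i) \in conj_set t B]|).
      by apply: subset_leq_card; apply/fintype.subsetP => b; rewrite !inE.
    by rewrite -addnn (leq_trans (leq_card_setU _ _))// leq_add// card_col_conj_set.
  (* The union has [N + N] cells minus the overlap; each overlapping cell costs at most
     [1 - q = 1 / n]. *)
  have := expr_sub_le #|B :|: conj_set t B| #|B :&: conj_set t B| q01.
  rewrite cU [1 - q](_ : _ = n%:R^-1) 1?mulrC; last by rewrite /q; ring.
  move=> /(le_trans (ler_norm _)) H2; move: H1 => /(le_trans (ler_norm _)); lra.
have {PU} : E (fun t => avoid_prob R (B :|: conj_set t B)) - q ^+ (N + N) <=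
    avoid_error N.*2 d.*2 + N%:R ^+ 2 / (n%:R * (n.-1)%:R) / n%:R.
  rewrite -[X in _ - X](expectation_cst n) -expectationB.
  apply: le_trans (expectation_le PU) _.
  rewrite expectationD expectation_cst expectationZ lerD2l mulrC.
  by rewrite ler_wpM2r ?invr_ge0// expectation_card_conj_setI.
by rewrite -/N; lra.
Qed.

End Conjugation.

(** * The corners of the grid and their link with Spearman's metric *)

Definition corner (n k : nat) : {set 'I_n * 'I_n} :=
  [set p : 'I_n * 'I_n | (n <= `|p.1 - p.2| + k)%N].

Lemma corner_diag n k (i : 'I_n) : (k < n)%N -> (i, i) \notin corner n k.
Proof. by move=> kn; rewrite inE /= -ltnNge; lia. Qed.

Lemma sum_ltn_ord n m : (\sum_(j < n) (j < m) = minn n m)%N.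
Proof.
elim: n => [|n IH]; first by rewrite big_ord0 min0n.
by rewrite big_ord_recr /= IH; case: ltnP; lia.
Qed.

(** The truncated terms with [i >= k] vanish, leaving a triangular number, doubled to avoid
    division. *)
Lemma sum_subn_ord n k : (k <= n -> \sum_(i < n) (k - i) * 2 = k * k.+1)%N.
Proof.
elim: n k => [|n IH] [|k] kn //; first by rewrite big_ord0.
  by rewrite big1.
rewrite big_ord_recl /= subn0; under eq_bigr do rewrite /= subSS.
by rewrite IH//; lia.
Qed.

(** A row meets the corners only in its first [k] and its last [k] columns. *)
Lemma card_row_corner n k (i : 'I_n) :
  (#|[set j | (i, j) \in corner n k]| <= k.*2)%N.
Proof.
rewrite -sum1_card big_mkcond /=.
apply: (@leq_trans (\sum_(j < n) ((j < k) + (rev_ord j < k)))%N).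
  apply: leq_sum => j _; rewrite !inE /=.
  by case: ifP => // h; have := ltn_ord i; have := ltn_ord j; lia.
have rev_sum : (\sum_(j < n) (rev_ord j < k) = \sum_(j < n) (j < k))%N.
  by rewrite (reindex_inj rev_ord_inj); apply: eq_bigr => j _; rewrite rev_ordK.
by rewrite big_split rev_sum /= sum_ltn_ord; lia.
Qed.

Lemma card_col_corner n k (j : 'I_n) :
  (#|[set i | (i, j) \in corner n k]| <= k.*2)%N.
Proof.
rewrite -(@eq_card _ [set i | (j, i) \in corner n k]) ?card_row_corner//.
by move=> i; rewrite !inE /=; lia.
Qed.

(** For [k < n] the corners are two disjoint triangles exchanged by transposing the grid. With the
    rows reversed, row [i] of the triangle [F] has [k - i] cells. *)
Lemma card_corner n k : (k < n)%N -> #|corner n k| = (k * k.+1)%N.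
Proof.
move=> kn; rewrite -sum1_card big_mkcond /=.
transitivity (\sum_i \sum_j (if (i, j) \in corner n k then 1 else 0))%N.
  by rewrite pair_bigA; apply: eq_bigr => -[i j].
pose F (i j : 'I_n) : nat := (j + n <= i + k)%N.
have -> : (\sum_i \sum_j (if (i, j) \in corner n k then 1 else 0) =
    \sum_i \sum_j F i j + \sum_i \sum_j F j i)%N.
  rewrite -big_split; apply: eq_bigr => i _.
  rewrite -big_split; apply: eq_bigr => j _.
  rewrite inE /= /F; case: (leqP n _); case: (leqP (j + n)); case: (leqP (i + n)); lia.
rewrite [X in (_ + X)%N]exchange_big /= addnn -muln2.
rewrite -(sum_subn_ord (ltnW kn)) -big_distrl /=; congr (_ * _)%N.
rewrite (reindex_inj rev_ord_inj) /=; apply: eq_bigr => i _.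
transitivity (\sum_(j < n) (j < k - i))%N; last by rewrite sum_ltn_ord; lia.
apply: eq_bigr => j _; rewrite /F /=; have := ltn_ord i.
by case: (leqP (j + n)); case: (ltnP j); lia.
Qed.

Lemma normalized_spearman_gt (R : realType) (n : nat) (s : 'S_n) (x : R) :
  0 <= x -> (0 < n)%N ->
  (x < normalized_spearman R s) =
    avoids (corner n (Num.truncn (x * Num.sqrt n%:R))) s.
Proof.
move=> x0 n0; set k := Num.truncn _.
have sn0 : 0 < Num.sqrt n%:R :> R by rewrite sqrtr_gt0 ltr0n.
have rho_le : (spearman_uniform s <= n)%N.
  by apply/bigmax_leqP => i _; have := ltn_ord i; have := ltn_ord (s i); lia.
(* As [n - rho] is a natural number, the real threshold can be replaced by its integer part [k]. *)
rewrite /normalized_spearman mulrC ltr_pdivlMr// -natrB// -truncn_lt_nat -/k; last first.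
  by rewrite mulr_ge0// ltW.
clearbody k; apply/idP/avoidsP => [kn i|h].
  rewrite inE /= -ltnNge; apply: (@leq_ltn_trans (spearman_uniform s + k)).
    by rewrite leq_add2r; apply: (@leq_bigmax _ (fun i : 'I_n => `|i - s i|%N)).
  by move: kn; lia.
(* For [k >= n] the corners fill the nonempty grid and cannot be avoided; hence [n - k.+1] below is
   not truncated. *)
have kn : (k < n)%N.
  by have := h (Ordinal n0); rewrite inE /=; lia.
suff : (spearman_uniform s <= n - k.+1)%N.
   by lia.
apply/bigmax_leqP => i _; have := h i; rewrite inE /= -ltnNge.
by rewrite leq_subRL// addSn addnC.
Qed.

Local Open Scope classical_set_scope.

(** * Limits for corners of width about [x * sqrt n] *)

Section Asymptotics.
Variables (R : realType) (x : R).
Hypothesis x0 : 0 <= x.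

Local Notation k n := (Num.truncn (x * Num.sqrt (n%:R : R))).

Lemma cvg_invn : (n%:R^-1 : R) @[n --> \oo] --> (0 : R).
Proof. by rewrite -cvg_shiftS; exact: cvg_harmonic. Qed.

Lemma cvg_invn_pred : ((n.-1)%:R^-1 : R) @[n --> \oo] --> (0 : R).
Proof. by rewrite -cvg_shiftS; exact: cvg_invn. Qed.

Lemma cvg_inv_sqrtn : ((Num.sqrt n%:R)^-1 : R) @[n --> \oo] --> (0 : R).
Proof.
rewrite -[X in _ --> X](@sqrtr0 R).
under eq_cvg do rewrite -sqrtrV//.
by apply: continuous_cvg; [exact: sqrt_continuous | exact: cvg_invn].
Qed.

Lemma cvg_corner_rate : ((k n)%:R / Num.sqrt n%:R : R) @[n --> \oo] --> x.
Proof.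
apply: (@squeeze_cvgr _ _ _ _ (fun n => x - (Num.sqrt n%:R)^-1) (cst x)); last 2 first.
- rewrite -[X in _ --> X]subr0; apply: cvgB; [exact: cvg_cst | exact: cvg_inv_sqrtn].
- exact: cvg_cst.
near=> n.
have n0 : (0 < n)%N by near: n; exact: nbhs_infty_gt.
have sn0 : 0 < Num.sqrt n%:R :> R by rewrite sqrtr_gt0 ltr0n.
have /andP[k1 k2] := truncn_itv (mulr_ge0 x0 (ltW sn0)).
rewrite ler_pdivlMr// ler_pdivrMr// k1 andbT mulrBl mulVf ?gt_eqF//.
by move: k2; rewrite -natr1; lra.
Unshelve. all: by end_near. Qed.

Lemma cvg_corner_width : ((k n)%:R / n%:R : R) @[n --> \oo] --> (0 : R).
Proof.
rewrite -(mulr0 x).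
apply: (cvg_trans _ (cvgM cvg_corner_rate cvg_inv_sqrtn)); apply: near_eq_cvg.
near=> n; rewrite /= -mulrA -invfM -expr2 sqr_sqrtr//.
Unshelve. all: by end_near. Qed.

Lemma cvg_corner_size : ((k n * (k n).+1)%N%:R / n%:R : R) @[n --> \oo] --> x ^+ 2.
Proof.
rewrite -[X in _ --> X]addr0.
apply: (cvg_trans _ (cvgD (cvgM cvg_corner_rate cvg_corner_rate) cvg_corner_width)).
apply: near_eq_cvg; near=> n.
rewrite fctE /= mulrACA -invfM -!expr2 sqr_sqrtr// natrM -natr1; ring.
Unshelve. all: by end_near. Qed.

Local Notation N n := (k n * (k n).+1)%N.

(** The factors [a], [b] are 1, 2 for the corners alone and 2, 4 for their union with a
    conjugate. *)
Lemma cvg_corner_avoid_error (a b : nat) :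
  avoid_error R n (N n * a)%N (k n * b)%N @[n --> \oo] --> (0 : R).
Proof.
pose u n : R := (N n)%:R / n%:R * a%:R.
pose v n : R := (k n)%:R / n%:R * (b%:R *+ 2).
have cu : u @ \oo --> x ^+ 2 * a%:R.
  by apply: cvgM; [exact: cvg_corner_size | exact: cvg_cst].
have cv : v @ \oo --> (0 : R).
  rewrite -(mul0r (b%:R *+ 2)).
  by apply: cvgM; [exact: cvg_corner_width | exact: cvg_cst].
rewrite (_ : 0 = x ^+ 2 * a%:R * (0 + x ^+ 2 * a%:R * 0)); last first.
  by rewrite mulr0 addr0 mulr0.
apply: (cvg_trans _ (cvgM cu (cvgD cv (cvgM cu cvg_invn_pred)))).
apply: near_eq_cvg; near=> n.
rewrite /avoid_error fctE /= /u /v (natrM _ (N n) a) (natrM _ (k n) b) invfM.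
by ring.
Unshelve. all: by end_near. Qed.

Lemma cvg_corner_overlap :
  ((N n)%:R ^+ 2 / (n%:R * (n.-1)%:R) / n%:R : R) @[n --> \oo] --> (0 : R).
Proof.
pose u n : R := (N n)%:R / n%:R.
have cu : u @ \oo --> x ^+ 2 := cvg_corner_size.
rewrite (_ : 0 = x ^+ 2 * (x ^+ 2 * 0)); last by rewrite !mulr0.
apply: (cvg_trans _ (cvgM cu (cvgM cu cvg_invn_pred))).
apply: near_eq_cvg; near=> n.
by rewrite /= /u invfM; ring.
Unshelve. all: by end_near. Qed.

Lemma corner_width_lt : \forall n \near \oo, (k n < n)%N.
Proof.
near=> n.
have n0 : (0 < n)%N by near: n; exact: nbhs_infty_gt.
suff : (k n)%:R / n%:R < 1 :> R by rewrite ltr_pdivrMr ?ltr0n// mul1r ltr_nat.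
by near: n; apply: (cvgr_lt _ cvg_corner_width).
Unshelve. all: by end_near. Qed.

(** Squeeze by [exp (- 1/(n-1)) <= 1 - 1/n <= exp (- 1/n)], raised to the number of cells. Both
    bounds come from [1 + y <= exp y], at [y = 1/(n-1)] after inversion and at [y = - 1/n]. *)
Lemma cvg_poisson_corner :
  (1 - n%:R^-1 : R) ^+ N n @[n --> \oo] --> expR (- x ^+ 2).
Proof.
pose u n : R := (N n)%:R / n%:R.
have cu : u @ \oo --> x ^+ 2 := cvg_corner_size.
apply: (@squeeze_cvgr _ _ _ _ (fun n => expR (- (u n * (1 + (n.-1)%:R^-1))))
   (fun n => expR (- u n))); last 2 first.
- apply: continuous_cvg; first exact: continuous_expR.
  apply: cvgN; rewrite -[X in _ --> X]mulr1; apply: cvgM => //.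
  rewrite -[X in _ --> X]addr0; apply: cvgD; [exact: cvg_cst | exact: cvg_invn_pred].
- by apply: continuous_cvg; [exact: continuous_expR | exact: cvgN].
near=> n.
have n1 : (1 < n)%N by near: n; exact: nbhs_infty_gt.
have n0R : 0 < n%:R :> R by rewrite ltr0n ltnW.
have n1R : 0 < (n.-1)%:R :> R by rewrite ltr0n -ltnS prednK// ltnW.
have nE : n%:R = (n.-1)%:R + 1 :> R by rewrite natr1 prednK// ltnW.
have -> : - u n = (N n)%:R * - n%:R^-1 by rewrite /u mulrN.
have -> : - (u n * (1 + (n.-1)%:R^-1)) = (N n)%:R * - (n.-1)%:R^-1.
  rewrite mulrN /u -mulrA; congr (- (_ * _)); rewrite nE.
  by field; rewrite -nE !gt_eqF.
rewrite !expRM_natl; apply/andP; split; last first.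
  by rewrite lerXn2r ?nnegrE ?expR_ge0 ?expR_ge1Dx// subr_ge0 invf_le1// ler1n ltnW.
rewrite lerXn2r ?nnegrE ?expR_ge0 ?subr_ge0 ?invf_le1 ?ler1n 1?ltnW//.
rewrite expRN -[leRHS]invrK.
rewrite lef_pV2 ?posrE ?expR_gt0 ?invr_gt0 ?subr_gt0 ?invf_lt1 ?ltr1n//.
apply: le_trans (expR_ge1Dx _).
rewrite le_eqVlt; apply/orP; left; apply/eqP; rewrite nE.
by field; rewrite -nE !gt_eqF.
Unshelve. all: by end_near. Qed.

Lemma cvg_avoid_prob_corner :
  avoid_prob R (corner n (k n)) @[n --> \oo] --> expR (- x ^+ 2).
Proof.
have := cvg_corner_avoid_error 1 2.
rewrite -(addr0 (expR _)) => err.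
rewrite -(_ : ((fun n => (1 - n%:R^-1 : R) ^+ N n) \+ (fun n =>
  avoid_prob R (corner n (k n)) - (1 - n%:R^-1 : R) ^+ N n)) =
  fun n => avoid_prob R (corner n (k n))); last first.
  by apply/funext => n /=; rewrite addrC subrK.
apply: cvgD; first exact: cvg_poisson_corner.
apply/norm_cvg0P; apply: (squeeze_cvgr _ (cvg_cst 0) err).
near=> n; rewrite normr_ge0/=.
have n0 : (0 < n)%N by near: n; exact: nbhs_infty_gt.
have kn : (k n < n)%N by near: n; exact: corner_width_lt.
have := @avoid_prob_approx R n (corner n (k n)) (k n).*2 n0
  (card_row_corner _) (card_col_corner _).
by rewrite card_corner// /avoid_error muln1 muln2.
Unshelve. all: by end_near. Qed.

Lemma cvg_corner_decorrelation (G : forall n, 'S_n -> R) (K : R) :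
  (forall n, class_function (G n)) -> (forall n s, `|G n s| <= K) ->
  perm_expectation (fun s => centered_avoids R (corner n (k n)) s * G n s)
    @[n --> \oo] --> (0 : R).
Proof.
move=> Gc GK; apply/norm_cvg0P.
(* The bound of [avoid_covariance] for [N n] cells with at most [2 k] in each row and column. *)
pose w n : R := avoid_error R n (N n * 2)%N (k n * 4)%N +
  (N n)%:R ^+ 2 / (n%:R * (n.-1)%:R) / n%:R +
  avoid_error R n (N n * 1)%N (k n * 2)%N *+ 2.
have cw : w @ \oo --> (0 : R).
  rewrite (_ : 0 = 0 + 0 + 0 *+ 2); last by rewrite mul0rn !addr0.
  apply: cvgD; last by apply: cvgMn; exact: cvg_corner_avoid_error.
  by apply: cvgD; [exact: cvg_corner_avoid_error | exact: cvg_corner_overlap].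
have cKw : K * Num.sqrt (w n) @[n --> \oo] --> (0 : R).
  rewrite -(mulr0 K) -(@sqrtr0 R); apply: cvgM; first exact: cvg_cst.
  by apply: continuous_cvg => //; exact: sqrt_continuous.
apply: (squeeze_cvgr _ (cvg_cst 0) cKw).
near=> n; rewrite normr_ge0/=.
have n0 : (0 < n)%N by near: n; exact: nbhs_infty_gt.
have kn : (k n < n)%N by near: n; exact: corner_width_lt.
apply: le_trans (class_function_decorrelation _ (Gc n) (GK n)) _.
rewrite ler_wpM2l//; first exact: le_trans (normr_ge0 _) (GK n 1%g).
rewrite ler_wsqrtr// /w.
have := @avoid_covariance R n (corner n (k n)) (k n).*2 n0
  (fun i => corner_diag i kn) (card_row_corner _) (card_col_corner _).
by rewrite card_corner// muln1 -!muln2 -(mulnA (k n) 2).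
Unshelve. all: by end_near. Qed.

End Asymptotics.

(** * Test functions asymptotically uncorrelated with a bounded sequence *)

Section Decoupling.
Variables (R : realType) (X G : forall n, 'S_n -> R) (K : R).
Hypothesis GK : forall n (s : 'S_n), `|G s| <= K.
Implicit Types phi psi : R -> R.

(** A difference, not a limit of products, since the expectation of [G] is not assumed to converge
    here. Convergence for [phi] is carried along so that linearity and approximation transfer both
    properties. *)
Definition decoupled phi : Prop :=
  cvgn (fun n => perm_expectation (fun s : 'S_n => phi (X s))) /\
  perm_expectation (fun s : 'S_n => phi (X s) * G s)
    - perm_expectation (fun s : 'S_n => phi (X s)) * perm_expectation (@G n)
    @[n --> \oo] --> (0 : R).

Lemma decoupled_cst (c : R) : decoupled (cst c).
Proof.
split; under [X in X @ _]funext => n do rewrite expectation_cst.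
  exact: is_cvg_cst.
under [X in X @ _]funext => n do rewrite expectationZ subrr.
exact: cvg_cst.
Qed.

Lemma decoupledD phi psi : decoupled phi -> decoupled psi ->
  decoupled (fun y => phi y + psi y).
Proof.
move=> [phi1 phi2] [psi1 psi2]; split.
  under [X in X @ _]funext => n do rewrite expectationD.
  exact: is_cvgD.
rewrite -(addr0 0); apply: cvg_trans (cvgD phi2 psi2); apply: near_eq_cvg.
near=> n; rewrite fctE /= expectationD.
under [X in _ = X - _]expectation_eq => s do rewrite mulrDl.
by rewrite expectationD; ring.
Unshelve. all: by end_near. Qed.

Lemma decoupledZ (c : R) phi : decoupled phi -> decoupled (fun y => c * phi y).
Proof.
move=> [phi1 phi2]; split.
  under [X in X @ _]funext => n do rewrite expectationZ.
  by apply: is_cvgM => //; exact: is_cvg_cst.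
rewrite -(mulr0 c); apply: cvg_trans (cvgM (cvg_cst c) phi2); apply: near_eq_cvg.
near=> n; rewrite /= expectationZ.
under [X in _ = X - _]expectation_eq => s do rewrite -mulrA.
by rewrite expectationZ; ring.
Unshelve. all: by end_near. Qed.

Lemma decoupled_sum (m : nat) (phi : nat -> R -> R) :
  (forall i, decoupled (phi i)) -> decoupled (fun y => \sum_(i < m) phi i y).
Proof.
move=> dphi; elim: m => [|m IH].
  by under [X in decoupled X]funext => y do rewrite big_ord0; exact: decoupled_cst.
under [X in decoupled X]funext => y do rewrite big_ord_recr.
exact: decoupledD.
Qed.

Lemma decoupled_approx phi :
  (forall e : R, 0 < e -> exists2 psi, decoupled psi &
     \forall n \near \oo,
       perm_expectation (fun s : 'S_n => `|phi (X s) - psi (X s)|) <= e) ->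
  decoupled phi.
Proof.
have K0 : 0 <= K := le_trans (normr_ge0 _) (GK (1%g : 'S_0)).
move=> approx; split.
  apply/cauchy_cvgP/cauchy_exP => e e0.
  have [psi [cpsi _] psie] := approx _ (divr_gt0 e0 (ltr0n R 2)).
  (* The limit for the approximant [psi] is the centre of the Cauchy ball of radius [e]. *)
  exists (limn (fun n => perm_expectation (fun s : 'S_n => psi (X s)))).
  have /cvgr_dist_lt /(_ _ (divr_gt0 e0 (ltr0n R 2))) := cpsi.
  apply: filterS2 psie => n /= psie lime.
  pose v := perm_expectation (fun s : 'S_n => psi (X s)).
  rewrite /ball /= -(subrK v (limn _)) -addrA.
  apply: le_lt_trans (ler_normD _ _) _; rewrite [e]splitr ltr_leD//.
  rewrite distrC -expectationB; exact: le_trans (expectation_norm _) psie.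
apply/cvgr0Pnorm_le => e e0.
(* An L^1 error [d] moves the covariance by at most [2 K d], which must stay below [e / 2]; the
   [+ 1] keeps the divisor positive when [K = 0]. *)
have c0 : 0 < 2 * (2 * K + 1) by rewrite mulr_gt0// ltr_wpDl// mulr_ge0.
have [psi [_ dpsi] psie] := approx _ (divr_gt0 e0 c0).
have /cvgr0_norm_le /(_ _ (divr_gt0 e0 (ltr0n R 2))) := dpsi.
apply: filterS2 psie => n /=; set d := perm_expectation _ => psie dpsie.
have EG : `|perm_expectation (@G n)| <= K.
  apply: le_trans (expectation_norm _) _.
  by rewrite -[leRHS](expectation_cst n); exact: expectation_le.
set a := perm_expectation (fun s => _ * _); set b := perm_expectation (fun s => phi _).
move: dpsie; set a' := perm_expectation (fun s => _ * _).
set b' := perm_expectation (fun s => psi _) => dpsie.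
have aa : `|a - a'| <= d * K.
  rewrite /a /a' -expectationB; apply: le_trans (expectation_norm _) _.
  rewrite mulrC -expectationZ; apply: expectation_le => s.
  by rewrite -mulrBl normrM mulrC ler_wpM2r.
have bb : `|b - b'| <= d by rewrite /b /b' -expectationB; exact: expectation_norm.
have -> : a - b * perm_expectation (@G n) =
   (a' - b' * perm_expectation (@G n)) + (a - a') - (b - b') * perm_expectation (@G n).
  by ring.
have bbG : `|(b - b') * perm_expectation (@G n)| <= d * K.
  by rewrite normrM ler_pM.
apply: le_trans (ler_normB _ _) _; apply: le_trans (lerD (ler_normD _ _) (lexx _)) _.
have : d * (2 * (2 * K + 1)) <= e by rewrite -ler_pdivlMr.
have d0 : 0 <= d := le_trans (normr_ge0 _) bb.
by move: aa bbG dpsie; lra.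
Qed.

End Decoupling.

(** * From half-lines to bounded continuous functions *)

Lemma bounded_fun_le (R : realType) (phi : R -> R) :
  bounded_fun phi -> exists M : R, forall y : R, `|phi y| <= M.
Proof.
move=> [M [_ phiM]]; exists (M + 1) => y.
by apply: (phiM (M + 1)) => //; rewrite ltrDl.
Qed.

Lemma uniform_continuity_segment (R : realType) (phi : R -> R) (L e : R) :
  continuous phi -> 0 < e ->
  exists2 d : R, 0 < d &
    forall y z, 0 <= y <= L -> `|y - z| < d -> `|phi y - phi z| <= e.
Proof.
move=> cphi e0.
have := @segment_compact R 0 L; rewrite compact_near_coveringP.
pose P (d y : R) := forall z, `|y - z| < d -> `|phi y - phi z| <= e.
move=> /(_ _ (0^'+) P _) [].
  move=> y _.
  have e20 : 0 < e / 2 by rewrite divr_gt0.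
  have /(cvgr_dist_lt)/(_ _ e20)/nbhs_ballP [r /= r0 yr] := cphi y.
  (* Half the radius for [u] and half for [d], so that both [u] and [z] fall within [r] of [y]. *)
  exists (ball y (r / 2), [set d | 0 < d < r / 2]).
    split => /=; first by apply: nbhsx_ballx; rewrite divr_gt0.
    by near=> d; apply/andP; split => //; near: d; apply: nbhs_right_lt; rewrite divr_gt0.
  move=> [u d] /= [yu /andP[d0 dr]] z uz.
  rewrite -(subrK (phi y) (phi u)) -addrA (le_trans (ler_normD _ _))//.
  rewrite [e]splitr lerD// ltW//.
    by rewrite distrC; apply: yr; apply: lt_trans yu _; lra.
  apply: yr; rewrite /ball /=; rewrite /ball /= in yu.
  have := ler_normD (y - u) (u - z); rewrite addrA subrK; move: yu uz dr; lra.
move=> r /= r0 rP; exists (r / 2); first by rewrite divr_gt0.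
move=> y z yL yz; apply: (rP (r / 2)) => //=; rewrite ?divr_gt0//.
  by rewrite sub0r normrN gtr0_norm ?divr_gt0//; lra.
Unshelve. all: by end_near. Qed.

(** A telescoping combination of half-line indicators, the form to which linearity of decoupling
    applies. On each interval from [i h] (excluded) to [(i+1) h] (included), [i < m], its value is
    that of [phi] at the right end. *)
Definition step_approx (R : realType) (phi : R -> R) (h : R) (m : nat)
    (y : R) : R :=
  phi 0 +
  \sum_(i < m) (phi (i.+1%:R * h) - phi (i%:R * h)) * (i%:R * h < y)%R%:R.

Lemma step_approx_right (R : realType) (phi : R -> R) (h : R) (m : nat) (y : R) :
  0 <= h -> m%:R * h < y -> step_approx phi h m y = phi (m%:R * h).
Proof.
rewrite /step_approx => h0; elim: m => [|m IH] mhy.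
  by rewrite big_ord0 addr0 mul0r.
have mhy' : m%:R * h < y by apply: le_lt_trans mhy; rewrite ler_wpM2r// ler_nat.
by rewrite big_ord_recr /= addrA IH// mhy' mulr1 addrC subrK.
Qed.

Lemma step_approx_near (R : realType) (phi : R -> R) (h e : R) (m : nat) (y : R) :
  0 <= h -> 0 <= e -> 0 <= y <= m%:R * h ->
  (forall z, `|y - z| <= h -> `|phi y - phi z| <= e) ->
  `|phi y - step_approx phi h m y| <= e.
Proof.
move=> h0 e0 + yh; elim: m => [|m IH] /andP[y0 ymh].
  rewrite /step_approx big_ord0 addr0 (_ : y = 0) ?subrr ?normr0//.
  by apply/eqP; rewrite eq_le y0 (le_trans ymh)// mul0r.
have -> : step_approx phi h m.+1 y = step_approx phi h m y +
    (phi (m.+1%:R * h) - phi (m%:R * h)) * (m%:R * h < y)%R%:R.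
  by rewrite /step_approx big_ord_recr addrA.
have [mhy|ymh'] := ltP; last by rewrite mulr0 addr0 IH// y0.
rewrite step_approx_right// mulr1 [X in _ - X]addrC subrK; apply: yh.
move: ymh mhy; rewrite -natr1 mulrDl mul1r => ymh mhy.
by rewrite ler_norml; apply/andP; split; lra.
Qed.

Section Tail.
Variables (R : realType) (X G : forall n, 'S_n -> R) (K : R).
Hypothesis GK : forall n (s : 'S_n), `|G s| <= K.
Hypothesis X0 : forall n (s : 'S_n), 0 <= X s.
Hypothesis dec_tail : forall x : R, 0 <= x ->
  decoupled X G (fun y => (x < y)%R%:R).
Hypothesis tight : forall e : R, 0 < e -> exists2 L : R, 0 < L &
  \forall n \near \oo, perm_expectation (fun s : 'S_n => (L < X s)%R%:R) <= e.

Lemma decoupled_continuous phi : bounded_fun phi -> continuous phi ->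
  decoupled X G phi.
Proof.
move=> bphi cphi; apply: (decoupled_approx GK) => e e0.
have [M phiM] := bounded_fun_le bphi.
have M0 : 0 <= M := le_trans (normr_ge0 _) (phiM 0).
have e20 : 0 < e / 2 by rewrite divr_gt0.
(* Beyond [L] the error is at most [2 M], and [2 M * (e / (4 M + 1)) <= e / 2]. *)
have c0 : 0 < 4 * M + 1 by rewrite ltr_wpDl// mulr_ge0.
have [L L0 tailL] := tight (divr_gt0 e0 c0).
have [d d0 phid] := uniform_continuity_segment L cphi e20.
pose m := (Num.truncn (L / d)).+1; pose h := L / m%:R.
have m0 : 0 < m%:R :> R by rewrite ltr0n.
have h0 : 0 <= h by rewrite divr_ge0// ltW.
have hd : h < d.
  by rewrite ltr_pdivrMr// mulrC -ltr_pdivrMr// /m; exact: truncnS_gt.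
have mh : m%:R * h = L by rewrite mulrC divfK// gt_eqF.
exists (step_approx phi h m).
  apply: decoupledD; first exact: decoupled_cst.
  apply: (@decoupled_sum _ X G m (fun i y =>
    (phi (i.+1%:R * h) - phi (i%:R * h)) * (i%:R * h < y)%R%:R)) => i.
  apply: decoupledZ; apply: dec_tail.
  by rewrite mulr_ge0.
apply: filterS tailL => n tailL.
have step_le (s : 'S_n) : `|phi (X s) - step_approx phi h m (X s)| <=
    e / 2 + 2 * M * (L < X s)%R%:R.
  have [LX|XL] := ltP L (X s).
    rewrite step_approx_right ?mh// mulr1 (le_trans (ler_normB _ _))//.
    by have := phiM (X s); have := phiM L; lra.
  rewrite mulr0 addr0; apply: step_approx_near => //; first exact: ltW.
    by rewrite mh X0.
  by move=> z Xz; apply: phid; [rewrite X0 | exact: le_lt_trans hd].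
apply: le_trans (expectation_le step_le) _.
rewrite expectationD expectation_cst expectationZ.
move: tailL; rewrite ler_pdivlMr// => tailL.
set t := perm_expectation _ in tailL *.
have t0 : 0 <= t.
  by rewrite -(expectation_cst n (0 : R)); apply: expectation_le.
lra.
Qed.

End Tail.

(** * Tail and tightness of the normalized metric, and the conclusion *)

Lemma normalized_spearman_ge0 (R : realType) n (s : 'S_n) :
  0 <= normalized_spearman R s.
Proof.
rewrite mulr_ge0 ?invr_ge0 ?sqrtr_ge0// subr_ge0 ler_nat.
by apply/bigmax_leqP => i _; have := ltn_ord i; have := ltn_ord (s i); lia.
Qed.

Lemma cvg_spearman_tail (R : realType) (x : R) : 0 <= x ->
  perm_expectation (fun s : 'S_n => (x < normalized_spearman R s)%R%:R)
    @[n --> \oo] --> expR (- x ^+ 2).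
Proof.
move=> x0; apply: cvg_trans (cvg_avoid_prob_corner x0); apply: near_eq_cvg.
near=> n; apply: expectation_eq => s; rewrite normalized_spearman_gt//.
by near: n; exact: nbhs_infty_gt.
Unshelve. all: by end_near. Qed.

Lemma spearman_tight (R : realType) (e : R) : 0 < e -> exists2 L : R, 0 < L &
  \forall n \near \oo,
    perm_expectation (fun s : 'S_n => (L < normalized_spearman R s)%R%:R) <= e.
Proof.
move=> e0; have L0 : 0 < e^-1 by rewrite invr_gt0.
(* With [L = 1/e] the limiting tail is below [e], because [exp (L^2) >= 1 + L^2 > L]. *)
exists e^-1 => //; apply: (cvgr_le _ (cvg_spearman_tail (ltW L0))).
rewrite expRN -[ltRHS]invrK ltf_pV2 ?posrE ?expR_gt0//.
apply: lt_le_trans (expR_ge1Dx _).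
have := sqr_ge0 (e^-1 - 1); nra.
Qed.

Lemma spearman_tail_decoupled (R : realType) (G : forall n, 'S_n -> R) (K x : R) :
  (forall n, class_function (G n)) -> (forall n s, `|G n s| <= K) -> 0 <= x ->
  decoupled (fun n (s : 'S_n) => normalized_spearman R s) G (fun y => (x < y)%R%:R).
Proof.
move=> Gc GK x0; split; first by apply/cvg_ex; eexists; exact: cvg_spearman_tail.
apply: cvg_trans (cvg_corner_decorrelation x0 Gc GK); apply: near_eq_cvg.
near=> n; have n0 : (0 < n)%N by near: n; exact: nbhs_infty_gt.
under expectation_eq => s do rewrite /centered_avoids mulrBl.
rewrite expectationB expectationZ /avoid_prob; congr (_ - _ * _);
  by apply: expectation_eq => s; rewrite normalized_spearman_gt.
Unshelve. all: by end_near. Qed.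

Theorem theorem7p4 (R : realType) (f : forall n : nat, {perm 'I_n} -> R)
    (hf : forall n : nat, class_function (f n)) (hlim : has_weak_limit f) :
  asymptotically_independent
    (fun (n : nat) (s : {perm 'I_n}) => normalized_spearman R s) f.
Proof.
move=> phi g bphi cphi bg cg EfX EgY EfXgY.
have [K gK] := bounded_fun_le bg.
have GK n (s : 'S_n) : `|g (f n s)| <= K by exact: gK.
have Gc n : class_function (fun s : 'S_n => g (f n s)).
  by move=> s t; rewrite hf.
have [cX dec] : decoupled (fun n (s : 'S_n) => normalized_spearman R s)
    (fun n s => g (f n s)) phi.
  apply: (@decoupled_continuous _ _ _ K) => //.
  - by move=> n s; exact: normalized_spearman_ge0.
  - by move=> x x0; exact: spearman_tail_decoupled GK x0.
  - exact: spearman_tight.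
have cY : cvgn EgY.
  by case: hlim => mu /(_ g bg cg) cg'; apply/cvg_ex; eexists; exact: cg'.
(* The joint expectation is a covariance tending to 0 plus the product of two convergent
   expectations. *)
have cXY : EfXgY @ \oo --> limn EfX * limn EgY.
  rewrite -[X in _ --> X]add0r.
  apply: cvg_trans (cvgD dec (cvgM cX cY)); apply: near_eq_cvg.
  by near=> n; rewrite fctE /= subrK.
split => //; first by apply/cvg_ex; eexists; exact: cXY.
exact: cvg_lim.
Unshelve. all: by end_near. Qed.
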